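(* Let $(E^t,\mathcal{E}^t)$, $t\in[0,\infty]$, be a family of measurable spaces, let $H$ be a non-empty subset of $\{(z^s)_{s\in[0,\infty]} : z^s\in E^s,\ s\in[0,\infty]\}$, and let $\mathcal{H}$ be the smallest $\sigma$-algebra on $H$ making the map $(z^s)_{s\in[0,\infty]}\mapsto z^t$ from $H$ to $(E^t,\mathcal{E}^t)$ measurable for every $t\in[0,\infty]$. Let $\mathbf{Z}_1,\mathbf{Z}_2,\dots,\mathbf{Z}$ be random elements in $(H,\mathcal{H})$. Then $$\forall t\in[0,\infty):\quad \mathbf{Z}_n^t\to\mathbf{Z}^t \text{ in density as } n\to\infty$$ if and only if there exist a sequence of numbers $0\leq t_1\leq t_2\leq\dots\to\infty$ (each $t_n\in[0,\infty)$) and a coupling $(\hat{\mathbf{Z}}_1^{t_1},\hat{\mathbf{Z}}_2^{t_2},\dots,\hat{\mathbf{Z}})$ of $\mathbf{Z}_1^{t_1},\mathbf{Z}_2^{t_2},\dots,\mathbf{Z}$ such that, for some $\mathbb{N}$-valued random variable $N$ (defined on the same probability space as the coupling), $$\hat{\mathbf{Z}}_n^{t_n}=\hat{\mathbf{Z}}^{t_n},\qquad n\geq N.$$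
   Context: $\mathbb{N}=\{1,2,\dots\}$. Segments: for $t\in[0,\infty)$, $(H^t,\mathcal{H}^t)$ is the image space of $(H,\mathcal{H})$ under the map $\pi_t$ taking $(z^s)_{s\in[0,\infty]}\in H$ to $(z^s)_{s\in[0,t)}$; that is, $H^t=\pi_t(H)$ and $\mathcal{H}^t=\{B\subseteq H^t:\pi_t^{-1}(B)\in\mathcal{H}\}$. For a random element $\mathbf{Z}=(Z^s)_{s\in[0,\infty]}$ in $(H,\mathcal{H})$ write $\mathbf{Z}^t=(Z^s)_{s\in[0,t)}=\pi_t(\mathbf{Z})$, a random element in $(H^t,\mathcal{H}^t)$. In particular $\hat{\mathbf{Z}}^{t_n}=\pi_{t_n}(\hat{\mathbf{Z}})$. Convergence in density: let $X_1,X_2,\dots,X$ be random elements in a measurable space with distributions $P_1,P_2,\dots,P$ having densities $f_1,f_2,\dots,f$ with respect to some measure $\lambda$ (such a $\lambda$ always exists, e.g. $\lambda=P+\sum_{n=1}^\infty 2^{-n}P_n$). Then $X_n\to X$ in density as $n\to\infty$ means $\liminf_{n\to\infty}f_n=f$ $\lambda$-a.e. This does not depend on $\lambda$ and is equivalent to $\liminf_{n\to\infty}\mathrm{d}P_n/\mathrm{d}P=1$ $P$-a.e., where $\mathrm{d}P_n/\mathrm{d}P$ is the Radon-Nikodym derivative of the absolutely continuous part of $P_n$ with respect to $P$. Coupling: a coupling of random elements $Y_1,Y_2,\dots,Y$ (each in its own measurable space, possibly defined on different probability spaces) is a family $(\hat Y_1,\hat Y_2,\dots,\hat Y)$ of random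 elements defined on a common probability space such that each $\hat Y_n$ has the same distribution as $Y_n$ and $\hat Y$ has the same distribution as $Y$. Here $\hat{\mathbf{Z}}_n^{t_n}$ is only a random element in $(H^{t_n},\mathcal{H}^{t_n})$ with the distribution of $\mathbf{Z}_n^{t_n}$ (it is not assumed to be a segment of a random element in $H$), while $\hat{\mathbf{Z}}$ is a random element in $(H,\mathcal{H})$ with the distribution of $\mathbf{Z}$. The final display means that for every outcome $\omega$ the equality holds for all $n\geq N(\omega)$. *)

(* Defs.v *)
From HB Require Import structures.
From mathcomp Require Import all_boot all_order all_algebra.
From mathcomp Require Import all_classical all_reals all_analysis.
From mathcomp Require Import measurable_realfun.

Set Implicit Arguments.
Unset Strict Implicit.
Unset Printing Implicit Defensive.

Import Order.TTheory GRing.Theory Num.Theory.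
Import numFieldNormedType.Exports.

Local Open Scope classical_set_scope.
Local Open Scope ring_scope.
Local Open Scope ereal_scope.

(* [time R] is the index set [0, +oo] and [before t] its part [0, t[. *)
Definition time (R : realType) : Type := {s : \bar R | 0 <= s}.

Definition before (R : realType) (t : R) : Type :=
  {s : time R | sval s < t%:E}.

(* In the library a [measurableType] is a pointed type. This loses nothing for
   the spaces E^s: the non-empty set H of paths makes each of them inhabited.
   The path space inherits a point from the proof H0 that H is non-empty, which
   is why its type depends on H0. *)
Definition path_carrier (R : realType) (d : time R -> measure_display)
  (E : forall s, measurableType (d s)) (H : set (forall s, E s))
  (H0 : H !=set0) : Type := set_type H.

Section path_space.
Context (R : realType) (d : time R -> measure_display).
Context (E : forall s, measurableType (d s)) (H : set (forall s, E s)).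
Context (H0 : H !=set0).

HB.instance Definition _ := gen_eqMixin (path_carrier H0).
HB.instance Definition _ := gen_choiceMixin (path_carrier H0).
HB.instance Definition _ := isPointed.Build (path_carrier H0)
  (SigSub (mem_set (projT2 (cid H0)))).

Definition path_coord (s : time R) (z : path_carrier H0) : E s := sval z s.

Definition coord_sets : set (set (path_carrier H0)) :=
  \bigcup_(s in [set: time R])
    preimage_set_system [set: path_carrier H0] (path_coord s) measurable.

Definition path_space := g_sigma_algebraType coord_sets.

HB.instance Definition _ := Measurable.on path_space.

End path_space.

Definition restrict_path (R : realType) (d : time R -> measure_display)
    (E : forall s, measurableType (d s)) (t : R) (z : forall s, E s) :
  forall s : before t, E (sval s) := fun s => z (sval s).

Definition segment_space (R : realType) (d : time R -> measure_display)
  (E : forall s, measurableType (d s)) (H : set (forall s, E s))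
  (H0 : H !=set0) (t : R) : Type := set_type (restrict_path (t := t) @` H).

Section segment_space.
Context (R : realType) (d : time R -> measure_display).
Context (E : forall s, measurableType (d s)) (H : set (forall s, E s)).
Context (H0 : H !=set0) (t : R).

Definition path_proj (z : path_space H0) : segment_space H0 t :=
  SigSub (mem_set (imageP (restrict_path (t := t)) (set_mem (svalP z)))).

HB.instance Definition _ := gen_eqMixin (segment_space H0 t).
HB.instance Definition _ := gen_choiceMixin (segment_space H0 t).
HB.instance Definition _ := isPointed.Build (segment_space H0 t)
  (path_proj point).

Definition segment_measurable : set (set (segment_space H0 t)) :=
  [set B | measurable (path_proj @^-1` B)].

Let segment_measurable0 : segment_measurable set0.
Proof. by rewrite /segment_measurable /= preimage_set0; exact: measurable0. Qed.

Let segment_measurableC : forall A, segment_measurable A ->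
  segment_measurable (~` A).
Proof.
by move=> A; rewrite /segment_measurable /= preimage_setC; exact: measurableC.
Qed.

Let segment_measurable_bigcup : forall F : (set (segment_space H0 t))^nat,
  (forall i, segment_measurable (F i)) ->
  segment_measurable (\bigcup_i F i).
Proof.
move=> F mF; rewrite /segment_measurable /= preimage_bigcup.
by apply: bigcupT_measurable => i; exact: mF.
Qed.

HB.instance Definition _ := isMeasurable.Build default_measure_display
  (segment_space H0 t) segment_measurable0 segment_measurableC
  segment_measurable_bigcup.

Let measurable_path_proj : measurable_fun [set: path_space H0] path_proj.
Proof. by move=> _ B mB; rewrite setTI; exact: mB. Qed.

HB.instance Definition _ := isMeasurableFun.Build _ _ _ _ path_proj
  measurable_path_proj.

End segment_space.
Arguments path_proj {R d E H H0} t z.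

Definition path_segment (R : realType) (d : time R -> measure_display)
    (E : forall s, measurableType (d s)) (H : set (forall s, E s))
    (H0 : H !=set0) (dO : measure_display) (Omega : measurableType dO)
    (P : probability Omega R) (t : R) (Z : {RV P >-> path_space H0}) :
  {RV P >-> segment_space H0 t} := path_proj t \o Z.

(* Densities take values in [0, +oo], as the library's Radon-Nikodym derivatives
   do; a density of a probability measure is finite almost everywhere. *)
Definition is_density (R : realType) (d : measure_display)
    (T : measurableType d) (lambda : {measure set T -> \bar R})
    (nu : probability T R) (f : T -> \bar R) : Prop :=
  [/\ measurable_fun [set: T] f, (forall x, 0 <= f x)
    & forall A, measurable A -> nu A = \int[lambda]_(x in A) f x].

(* A dominating measure lambda always exists and the property does not depend
   on it nor on the versions of the densities, whence the existential. *)
Definition cvg_in_density (R : realType) (d : measure_display)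
    (T : measurableType d) (dO : nat -> measure_display)
    (Omega : forall n, measurableType (dO n))
    (P : forall n, probability (Omega n) R)
    (X : forall n, {RV (P n) >-> T})
    (dO_oo : measure_display) (Omega_oo : measurableType dO_oo)
    (P_oo : probability Omega_oo R) (X_oo : {RV P_oo >-> T}) : Prop :=
  exists (lambda : {measure set T -> \bar R})
         (f : nat -> T -> \bar R) (f_oo : T -> \bar R),
    [/\ forall n, is_density lambda (distribution (P n) (X n)) (f n),
        is_density lambda (distribution P_oo X_oo) f_oo
      & \forall x \ae lambda, limn_einf (fun n => f n x) = f_oo x].

Definition same_law (R : realType) (d : measure_display) (T : measurableType d)
    (d1 : measure_display) (Omega1 : measurableType d1)
    (P1 : probability Omega1 R) (X1 : {RV P1 >-> T})
    (d2 : measure_display) (Omega2 : measurableType d2)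
    (P2 : probability Omega2 R) (X2 : {RV P2 >-> T}) : Prop :=
  forall A, measurable A -> distribution P1 X1 A = distribution P2 X2 A.

Definition is_coupling (R : realType)
    (d : nat -> measure_display) (T : forall n, measurableType (d n))
    (d_oo : measure_display) (T_oo : measurableType d_oo)
    (dO : nat -> measure_display) (Omega : forall n, measurableType (dO n))
    (P : forall n, probability (Omega n) R)
    (Y : forall n, {RV (P n) >-> T n})
    (dO_oo : measure_display) (Omega_oo : measurableType dO_oo)
    (P_oo : probability Omega_oo R) (Y_oo : {RV P_oo >-> T_oo})
    (dQ : measure_display) (Omega' : measurableType dQ)
    (Q : probability Omega' R)
    (Yhat : forall n, {RV Q >-> T n}) (Yhat_oo : {RV Q >-> T_oo}) : Prop :=
  (forall n, same_law (Yhat n) (Y n)) /\ same_law Yhat_oo Y_oo.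

(* Main.v *)
(* Convergence in density of X_n to X amounts to the following: for every
   e > 0 there is a measure nu of mass > 1 - e lying below the law of X and, for
   all large n, below the law of X_n.  From densities, nu has density
   min(inf_(n >= m) f_n, f); conversely the densities of such nu bound
   liminf f_n from below, and Fatou's lemma bounds its integral by 1.

   A coupling provides such nu on each [0, t[: the law of the restriction of
   Zhat to the event N <= m.  Conversely, take such nu_k on the segments [0, k[
   with mass >= 1 - 2^-k, valid for n >= m_k, and let phi_k be their densities
   with respect to the law of Z, lifted to the path space.  Let t_n tend to
   infinity so slowly that m_(t_n) <= n.  The functions
   psi_n = inf_(j >= t_n) phi_j increase to 1 in mean and, on [0, t_n[, the
   measure psi_n * law(Z) lies below the law of Z_n.  So one may take N with
   P(N <= n | Zhat) = psi_n(Zhat), put Zhat_n = Zhat on [0, t_n[ if N <= n, and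
   otherwise draw Zhat_n from the normalised remainder of the law of Z_n. *)
Require Import Defs.
From HB Require Import structures.
From mathcomp Require Import all_boot all_order all_algebra.
From mathcomp Require Import all_classical all_reals all_analysis.
From mathcomp Require Import measurable_realfun lra.

Set Implicit Arguments.
Unset Strict Implicit.
Unset Printing Implicit Defensive.

Import Order.TTheory GRing.Theory Num.Theory.
Import numFieldNormedType.Exports.

Local Open Scope classical_set_scope.
Local Open Scope ring_scope.

(** * Bundling of measurable functions and measures *)

Definition mfun_of_measurable d d' (T : measurableType d)
    (U : measurableType d') (f : T -> U) (mf : measurable_fun [set: T] f) :
    {mfun T >-> U} :=
  HB.pack_for {mfun T >-> U} f (isMeasurableFun.Build _ _ _ _ f mf).

Lemma exists_pushforward (R : realFieldType) d d' (T : measurableType d)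
    (U : measurableType d') (mu : {measure set T -> \bar R}) (f : T -> U) :
  measurable_fun [set: T] f ->
  exists nu : {measure set U -> \bar R}, forall A, nu A = mu (f @^-1` A).
Proof. by move=> mf; unshelve eexists (pushforward mu f). Qed.

Section bounded_measures.
Context d (T : measurableType d) (R : realType).
Variable m : {measure set T -> \bar R}.

(** The proof is an argument so that the instances declared below can be inferred from the term; the
    set function itself remains [m]. *)
Definition finite_of_measure of fin_num_fun m : set T -> \bar R := m.

Definition probability_of_measure of m [set: T] = 1%E : set T -> \bar R := m.

Variables (mfin : fin_num_fun m) (mT : m [set: T] = 1%E).

HB.instance Definition _ := Measure.on (finite_of_measure mfin).

HB.instance Definition _ :=
  Measure_isFinite.Build _ _ _ (finite_of_measure mfin) mfin.

HB.instance Definition _ := Measure.on (probability_of_measure mT).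

HB.instance Definition _ :=
  Measure_isProbability.Build _ _ _ (probability_of_measure mT) mT.

End bounded_measures.

(** * Densities of dominated measures and comparison of measures *)

Section measures_with_density.
Local Open Scope ereal_scope.
Context d (T : measurableType d) (R : realType).
Implicit Types (mu : {measure set T -> \bar R}) (f g : T -> \bar R).

Lemma density_measure mu f :
  measurable_fun [set: T] f -> (forall x, 0 <= f x) ->
  exists nu : {measure set T -> \bar R},
    forall A, measurable A -> nu A = \int[mu]_(x in A) f x.
Proof.
move=> mf f0; pose nu (A : set T) := \int[mu]_(x in A) f x.
have nu0 : nu set0 = 0 by rewrite /nu integral_set0.
have nu_ge0 A : 0 <= nu A by apply: integral_ge0 => x _; exact: f0.
have nu_sigma : semi_sigma_additive nu.
  move=> F mF tF mUF; rewrite /nu ge0_integral_bigcup//.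
    by apply: is_cvg_nneseries => n _ _; exact: nu_ge0.
  exact: measurable_funTS.
by exists (HB.pack_for {measure set T -> \bar R} nu
  (isMeasure.Build _ _ _ nu nu0 nu_ge0 nu_sigma)).
Qed.

(** On [D], where [g < f], the hypothesis forces [f] and [g] to have equal integrals over every
    measurable subset. As [g] is integrable, they agree a.e. on [D], so [D] is null. *)
Lemma ae_le_integral mu f g :
  measurable_fun [set: T] f -> measurable_fun [set: T] g ->
  (forall x, 0 <= f x) -> (forall x, 0 <= g x) -> \int[mu]_x g x < +oo ->
  (forall A, measurable A -> \int[mu]_(x in A) f x <= \int[mu]_(x in A) g x) ->
  {ae mu, forall x, f x <= g x}.
Proof.
move=> mf mg f0 g0 goo fg; pose D := [set x | g x < f x].
have mD : measurable D.
  by rewrite -[D]setTI; exact: measurable_lte.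
have gi : mu.-integrable D g.
  apply/integrableP; split; first exact: measurable_funTS.
  under eq_integral do rewrite gee0_abs//.
  by apply: le_lt_trans goo; exact: ge0_subset_integral.
have gf : ae_eq mu D g f.
  apply: integral_ae_eq => //; first exact: measurable_funTS.
  move=> E ED mE; apply/eqP; rewrite eq_le fg// andbT.
  apply: ge0_le_integral => //; try exact: measurable_funTS.
  by move=> x /ED /ltW.
apply: filterS gf => x /= gf.
by rewrite leNgt; apply/negP => gfx; have := gfx; rewrite gf// ltxx.
Qed.

Lemma exists_density (mu : {sigma_finite_measure set T -> \bar R})
    (nu : {finite_measure set T -> \bar R}) : nu `<< mu ->
  exists f, [/\ measurable_fun [set: T] f, (forall x, 0 <= f x)
    & forall A, measurable A -> nu A = \int[mu]_(x in A) f x].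
Proof.
move=> numu; exists (Radon_Nikodym_SigmaFinite.f nu mu); split.
- by have /integrableP[] := Radon_Nikodym_SigmaFinite.f_integrable numu.
- exact: Radon_Nikodym_SigmaFinite.f_ge0.
- exact: Radon_Nikodym_SigmaFinite.f_integral.
Qed.

(** A Radon-Nikodym density of [nu] is at most 1 a.e.; truncating it at 1 leaves its integrals
    unchanged and makes the bound hold at every point, so that [1 - f] is nonnegative everywhere. *)
Lemma exists_density_le1 (mu : {finite_measure set T -> \bar R})
    (nu : {measure set T -> \bar R}) :
  (forall A, measurable A -> nu A <= mu A) ->
  exists f, [/\ measurable_fun [set: T] f, (forall x, 0 <= f x <= 1)
    & forall A, measurable A -> nu A = \int[mu]_(x in A) f x].
Proof.
move=> numu.
have nufin : fin_num_fun nu.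
  move=> A mA; rewrite ge0_fin_numE//.
  by rewrite (le_lt_trans (numu _ mA))// ltey_eq fin_num_measure.
pose nu' : {finite_measure set T -> \bar R} := finite_of_measure nufin.
have dom : nu' `<< mu.
  apply/null_content_dominatesP => A mA muA.
  by apply/eqP; rewrite eq_le measure_ge0 andbT -muA; exact: numu.
have [f [mf f0 nuf]] := exists_density dom.
have muT : \int[mu]_x (cst 1 x) = mu [set: T].
  by rewrite integral_cst// mul1e.
have fle1 : {ae mu, forall x, f x <= cst 1 x}.
  apply: ae_le_integral => //; first by rewrite muT ltey_eq fin_num_measure.
  move=> A mA; rewrite -nuf// integral_cst// mul1e; exact: numu.
exists (fun x => mine (f x) 1); split.
- exact: measurable_mine.
- by move=> x; rewrite le_min f0 lee01 ge_min lexx orbT.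
move=> A mA; rewrite [LHS]nuf//; apply: ge0_ae_eq_integral => //.
- exact: measurable_funTS.
- by apply: measurable_funTS; exact: measurable_mine.
- by move=> x _; rewrite le_min f0 lee01.
by apply: filterS fle1 => x /= fx1 _; apply/esym/min_idPl.
Qed.

End measures_with_density.

(** The density is taken on [S] with respect to the image of [p] and then composed with [h]; the
    change of variables formula brings the integral back to [T]. *)
Lemma exists_density_comp (R : realType) d (T : measurableType d) dS
    (S : measurableType dS) (h : {mfun T >-> S})
    (p : {finite_measure set T -> \bar R}) (nu : {measure set S -> \bar R}) :
  (forall B, measurable B -> nu B <= p (h @^-1` B))%E ->
  exists f : T -> \bar R, [/\ measurable_fun [set: T] f,
    (forall x, 0 <= f x <= 1)%E
    & forall B, measurable B -> nu B = \int[p]_(x in h @^-1` B) f x]%E.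
Proof.
move=> nup.
have fin : fin_num_fun (pushforward p h).
  by move=> A mA; apply: fin_num_measure; exact: measurable_funPTI.
pose q : {finite_measure set S -> \bar R} := finite_of_measure fin.
have [f [mf f01 nuf]] := exists_density_le1 (mu := q (measurable_funPT h)) nup.
exists (f \o h); split => //.
- exact: measurableT_comp.
- by move=> x /=; exact: f01.
move=> B mB; rewrite nuf// ge0_integral_pushforward//.
  exact: measurable_funTS.
by move=> y _; have /andP[] := f01 y.
Qed.

(** The sum of the [q n] with weights 2^-(n+1) has mass 1, and its null sets are null for each
    term. *)
Lemma exists_dominating_measure (R : realType) d (T : measurableType d)
    (q : nat -> probability T R) :
  exists lambda : {finite_measure set T -> \bar R}, forall n, q n `<< lambda.
Proof.
have c0 (n : nat) : (0 <= 1 / (2 ^ (n + 1))%:R :> R)%R by rewrite divr_ge0.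
pose c n := NngNum (c0 n).
pose l := mseries (fun n => mscale (c n) (q n)) 0.
have lfin : fin_num_fun l.
  apply: lty_fin_num_fun.
  suff : l [set: T] = (1 / 2 ^+ 0)%:E.
    by move=> lT; exact: (eq_ind_r (fun x => x < +oo)%E (ltry _) lT).
  rewrite -(cvg_lim _ (@cvg_geometric_eseries_half R 1 0))//.
  apply: eq_eseriesr => k _.
  by rewrite -[RHS]mule1 -(probability_setT (q k)).
exists (finite_of_measure lfin) => n.
apply/null_content_dominatesP => A mA lA.
have term_le : (mscale (c n) (q n) A <= 0)%E.
  rewrite -lA /finite_of_measure /= /mseries.
  rewrite (nneseriesD1 (n := n))//.
  by apply: leeDl; apply: nneseries_ge0 => k _ _; exact: measure_ge0.
apply/eqP; have : mscale (c n) (q n) A == 0%E.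
  by rewrite eq_le term_le measure_ge0.
rewrite /mscale mule_eq0 => /orP[|//].
by rewrite eqe /= gt_eqF// divr_gt0// ltr0n expn_gt0.
Qed.

(** Apply [nu <= p] to the complement of [A]: a mass defect of at most [e] in total is at most [e]
    on each set. *)
Lemma le_probability_of_mass (R : realType) d (T : measurableType d)
    (p : probability T R) (nu : {measure set T -> \bar R}) (e : R) :
  (forall A, measurable A -> nu A <= p A)%E -> (1 - e%:E <= nu [set: T])%E ->
  forall A, measurable A -> (p A <= nu A + e%:E)%E.
Proof.
move=> nup nu_mass A mA.
have : (1 - e%:E <= nu A + (1 - p A))%E.
  rewrite -probability_setC//; apply: le_trans nu_mass _.
  rewrite -(setUv A) measureU//; [|exact: measurableC|by rewrite setICr].
  by rewrite leeD2l// nup//; exact: measurableC.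
have nuA : nu A \is a fin_num.
  by rewrite ge0_fin_numE// (le_lt_trans (nup _ mA))// ltey_eq fin_num_measure.
rewrite -(fineK nuA) -(fineK (fin_num_measure p _ mA)) -!EFinB -!EFinD !lee_fin.
lra.
Qed.

(** * Convergence in density expressed through common parts of the laws *)

Section convergence_in_density.
Local Open Scope ereal_scope.
Context (R : realType) d (T : measurableType d).
Context (dO : nat -> measure_display) (Omega : forall n, measurableType (dO n)).
Context (P : forall n, probability (Omega n) R).
Context (X : forall n, {RV (P n) >-> T}).
Context (dO_oo : measure_display) (Omega_oo : measurableType dO_oo).
Context (P_oo : probability Omega_oo R) (X_oo : {RV P_oo >-> T}).

Local Notation q := (fun n => distribution (P n) (X n)).
Local Notation q_oo := (distribution P_oo X_oo).

Definition common_part (nu : {measure set T -> \bar R}) (m : nat) :=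
  forall A, measurable A ->
    nu A <= q_oo A /\ forall n, (m <= n)%N -> nu A <= q n A.

Lemma cvg_in_density_common_part : cvg_in_density X X_oo ->
  forall e : R, (0 < e)%R ->
  exists (nu : {measure set T -> \bar R}) (m : nat),
    common_part nu m /\ 1 - e%:E < nu [set: T].
Proof.
move=> [lambda [f [f_oo [fq [mf_oo f_oo0 f_ooq] fcvg]]]] e e0.
have mf n : measurable_fun [set: T] (f n) by case: (fq n).
have f0 n x : 0 <= f n x by case: (fq n).
(* The tail infimum is below [f_oo] only a.e.; the minimum makes this hold at every point. *)
pose g m x := mine (einfs (fun n => f n x) m) (f_oo x).
have einfs0 m x : 0 <= einfs (fun n => f n x) m.
  by apply: le_ereal_inf_tmp => _ [n _ <-].
have mg m : measurable_fun [set: T] (g m).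
  by apply: measurable_mine => //; exact: measurable_fun_einfs.
have g0 m x : 0 <= g m x by rewrite le_min einfs0 f_oo0.
have ndg x : nondecreasing_seq (g ^~ x).
  move=> m n mn; rewrite /g le_min ge_min (nondecreasing_einfs _ mn)/=.
  by rewrite ge_min lexx orbT.
have intg_nd : nondecreasing_seq (fun m => \int[lambda]_x g m x).
  by move=> m n mn; apply: ge0_le_integral => // x _; exact: ndg.
(* Monotone convergence: a.e. the minimum in [g m] is the tail infimum, which increases to [f_oo], a
   density of total mass 1. *)
have : ereal_sup (range (fun m => \int[lambda]_x g m x)) = 1.
  rewrite -(cvg_lim _ (ereal_nondecreasing_cvgn intg_nd))//.
  rewrite -monotone_convergence//.
  rewrite -(probability_setT q_oo) f_ooq//.
  apply: ge0_ae_eq_integral => //.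
  - apply: (emeasurable_fun_cvg g) => // x _.
    exact: ereal_nondecreasing_is_cvgn.
  - move=> x _; apply: lime_ge; last exact: nearW.
    exact: ereal_nondecreasing_is_cvgn.
  apply: filterS fcvg => x /= fx _.
  have gE m : g m x = einfs (fun n => f n x) m.
    apply/min_idPl; rewrite -fx limn_einf_lim.
    rewrite (cvg_lim _ (@cvg_einfs_sup _ _))//.
    by apply: ereal_sup_ubound; exists m.
  by rewrite -fx limn_einf_lim; congr (limn _); apply/funext => m; exact: gE.
move=> sup1; have [|_ [m _ <-] gm] := @ereal_sup_gt _
    (range (fun m => \int[lambda]_x g m x)) (1 - e%:E).
  by rewrite sup1 -EFinB lte_fin ltrBlDr ltrDl.
have [nu nuE] := density_measure lambda (mg m) (g0 m).
exists nu, m; split; last by rewrite nuE.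
move=> A mA; rewrite nuE//; split=> [|n mn].
  rewrite f_ooq//; apply: ge0_le_integral => //; try exact: measurable_funTS.
  by move=> x _; rewrite ge_min lexx orbT.
have [_ _ ->//] := fq n.
apply: ge0_le_integral => //; try exact: measurable_funTS.
by move=> x _; rewrite ge_min ereal_inf_lbound//; exists n.
Qed.

Lemma common_part_cvg_in_density :
  (forall e : R, (0 < e)%R ->
    exists (nu : {measure set T -> \bar R}) (m : nat),
      common_part nu m /\ 1 - e%:E < nu [set: T]) ->
  cvg_in_density X X_oo.
Proof.
move=> common.
(* Index 0 carries the limit law and index [n.+1] carries [q n]. *)
have [lambda qlambda] := @exists_dominating_measure R _ T
  (fun n => if n is k.+1 then q k else q_oo).
have [f_oo f_oo_density] : exists f_oo, is_density lambda q_oo f_oo.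
  exact: exists_density (qlambda 0%N).
have [mf_oo f_oo0 f_ooq] := f_oo_density.
have /choice[f fq] : forall n, exists fn, is_density lambda (q n) fn.
  by move=> n; exact: exists_density (qlambda n.+1).
have mf n : measurable_fun [set: T] (f n) by case: (fq n).
have f0 n x : 0 <= f n x by case: (fq n).
exists lambda, f, f_oo; split => //.
pose h x := limn_einf (fun n => f n x).
have mh : measurable_fun [set: T] h.
  apply: (emeasurable_fun_cvg (fun m x => einfs (fun n => f n x) m)) => [m|x _].
    exact: measurable_fun_einfs.
  by rewrite /h limn_einf_lim; exact: is_cvg_einfs.
have einfs_le_h m x : einfs (fun n => f n x) m <= h x.
  rewrite /h limn_einf_lim (cvg_lim _ (@cvg_einfs_sup _ _))//.
  by apply: ereal_sup_ubound; exists m.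
have h0 x : 0 <= h x.
  apply: le_trans (einfs_le_h 0%N x).
  by apply: le_ereal_inf_tmp => _ [n _ <-].
have int_h1 : \int[lambda]_x h x <= 1.
  apply: le_trans (fatou _ _ _ _) _ => //.
  rewrite (_ : (fun n => _) = cst 1).
    by have [-> _] := cvg_limn_einf_sup (@cvg_cst (\bar R) 1 nat \oo _).
  by apply/funext => n; have [_ _ <-//] := fq n; rewrite probability_setT.
have q_le_h A : measurable A -> q_oo A <= \int[lambda]_(x in A) h x.
  move=> mA; apply/lee_addgt0Pr => e e0.
  have [nu [m [nu_common nu_mass]]] := common _ e0.
  have nufin : fin_num_fun nu.
    move=> B mB; rewrite ge0_fin_numE// (le_lt_trans (nu_common _ mB).1)//.
    by rewrite ltey_eq fin_num_measure.
  have nulambda : finite_of_measure nufin `<< lambda.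
    apply/null_content_dominatesP => B mB lambdaB.
    have qB : q_oo B = 0 by move/null_content_dominatesP: (qlambda 0%N); exact.
    apply/eqP; rewrite eq_le measure_ge0 andbT -qB.
    exact: (nu_common _ mB).1.
  have [g [mg g0 nug]] := exists_density nulambda.
  (* The inequalities [g <= f n] for [n >= m] are countably many, so they hold simultaneously a.e.
     and pass to the tail infimum. *)
  have g_le_h : {ae lambda, forall x, g x <= h x}.
    have : {ae lambda, forall x, forall n, g x <= f (n + m)%N x}.
      apply: ae_foralln => n.
      apply: ae_le_integral => //.
        by have [_ _ <-//] := fq (n + m)%N; rewrite probability_setT ltry.
      move=> B mB; rewrite -nug//; have [_ _ <-//] := fq (n + m)%N.
      by have [_] := nu_common _ mB; apply; exact: leq_addl.
    apply: filterS => x gf; apply: le_trans (einfs_le_h m x).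
    by apply: le_ereal_inf_tmp => _ [n /= mn <-]; rewrite -(subnK mn).
  apply: (@le_trans _ _ (nu A + e%:E)).
    apply: le_probability_of_mass => //; last exact: ltW.
    by move=> B mB; exact: (nu_common _ mB).1.
  rewrite leeD2r//.
  rewrite [leLHS](nug _ mA).
  apply: ae_ge0_le_integral => //; try exact: measurable_funTS.
  by apply: filterS g_le_h.
(* The integral of [h] is at least [q_oo] on [E] and on its complement, yet at most 1 in total, so
   equality holds on every measurable [E]. *)
apply: filterS (@integral_ae_eq _ _ _ lambda setT measurableT h f_oo _ _ _).
- by move=> x /= ->.
- apply/integrableP; split=> //.
  under eq_integral do rewrite gee0_abs//.
  by rewrite -f_ooq// probability_setT ltry.
- by [].
move=> E _ mE; rewrite -f_ooq//; apply/eqP; rewrite eq_le q_le_h//=.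
rewrite -(@leeD2rE _ (q_oo (~` E))); last first.
  by rewrite fin_num_measure//; exact: measurableC.
have -> : q_oo E + q_oo (~` E) = 1.
  by rewrite probability_setC// addeC subeK// fin_num_measure.
apply: le_trans int_h1; rewrite -(setUv E) ge0_integral_setU//.
- by rewrite leeD2l// q_le_h//; exact: measurableC.
- exact: measurableC.
- exact: measurable_funTS.
- by rewrite disj_set2E setICr.
Qed.
End convergence_in_density.

(** * Sequences with prescribed laws of finitely many coordinates *)

Section sequence_space.
Context (R : realType) d (T : measurableType d).

Definition seq_cylinders : set (set (nat -> T)) :=
  \bigcup_(i in [set: nat])
    preimage_set_system [set: nat -> T] (fun w => w i) measurable.

Definition seq_space := g_sigma_algebraType seq_cylinders.

HB.instance Definition _ := Measurable.on seq_space.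

Definition seq_coord (i : nat) (w : seq_space) : T := w i.

Lemma measurable_seq_coord i : measurable_fun [set: seq_space] (seq_coord i).
Proof. by move=> _ A mA; apply: sub_sigma_algebra; exists i => //; exists A. Qed.

Lemma measurable_to_seq_space d' (U : measurableType d') (f : U -> seq_space) :
  (forall i, measurable_fun [set: U] (seq_coord i \o f)) ->
  measurable_fun [set: U] f.
Proof.
move=> mf; apply: (@measurability _ _ U seq_space setT f seq_cylinders erefl).
move=> _ [_ [i _ [A mA <-]] <-].
by rewrite !setTI -comp_preimage -[X in measurable X]setTI; exact: mf.
Qed.

Definition seq_update k (x : seq_space * T) : seq_space :=
  fun i => if i == k then x.2 else x.1 i.

Lemma measurable_seq_update k :
  measurable_fun [set: seq_space * T] (seq_update k).
Proof.
apply: measurable_to_seq_space => i.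
have [ik|ik] := eqVneq i k.
  rewrite (_ : _ \o _ = snd) ?ik//.
  by apply/funext => x; rewrite /= /seq_coord /seq_update eqxx.
rewrite (_ : _ \o _ = seq_coord i \o fst).
  by apply: measurableT_comp => //; exact: measurable_seq_coord.
by apply/funext => x; rewrite /= /seq_coord /seq_update (negbTE ik).
Qed.

(* On the event N = k only the first k variables have to be drawn apart from
   Zhat, so binary products suffice and no infinite product measure is needed. *)
Lemma exists_finite_marginals (r : nat -> probability T R) (k : nat) :
  exists m : probability seq_space R, forall i A, (i < k)%N -> measurable A ->
    m (seq_coord i @^-1` A) = r i A.
Proof.
elim: k => [|k [m mr]]; first by exists (\d_ (point : seq_space)).
(* Overwrite coordinate [k] of a sequence with law [m] by an independent draw from [r k]. *)
exists (distribution (m \x r k)%E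
  (mfun_of_measurable (measurable_seq_update k))) => i A.
rewrite ltnS leq_eqVlt => ik mA.
have [eik|nik] := eqVneq i k.
  transitivity ((m \x r k)%E (setT `*` A)).
    congr product_measure1; apply/seteqP; split=> [[w x]|[w x] []] /=;
      by rewrite /seq_coord /seq_update eik eqxx.
  rewrite product_measure1E// [X in (X * _)%E](_ : _ = 1%E) ?mul1e ?eik//.
  exact: probability_setT.
transitivity ((m \x r k)%E (seq_coord i @^-1` A `*` setT)).
  congr product_measure1; apply/seteqP; split=> [[w x]|[w x] []] /=;
    by rewrite /seq_coord /seq_update (negbTE nik).
rewrite product_measure1E//.
  rewrite [X in (_ * X)%E](_ : _ = 1%E) ?mule1; last exact: probability_setT.
  by apply: mr => //; move: ik; rewrite (negbTE nik).
by rewrite -[X in measurable X]setTI; exact: measurable_seq_coord.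
Qed.

End sequence_space.

(** * Construction of a coupling with eventual equality *)

Section coupling.
Local Open Scope ereal_scope.
Context (R : realType) d (T : measurableType d).

(* The remainder of the image of q is realised on T itself, so that the
   remainders for the different segments all live on one space. *)
Lemma exists_residual (q : probability T R) dS (S : measurableType dS)
    (h : {mfun T >-> S}) (nu : {measure set S -> \bar R}) :
  (forall B, measurable B -> nu B <= q (h @^-1` B)) ->
  exists r : probability T R, forall B, measurable B ->
    nu B + (1 - nu [set: S]) * r (h @^-1` B) = q (h @^-1` B).
Proof.
move=> nuq; have [f [mf f01 nuf]] := exists_density_comp nuq.
have mf1 : measurable_fun [set: T] (fun x => 1 - f x).
  exact: emeasurable_funB.
have f1_ge0 x : 0 <= 1 - f x by rewrite subre_ge0//; have /andP[] := f01 x.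
(* The image of [mu] under [h] is what remains of the image of [q] after removing [nu]. *)
have [mu muE] := density_measure q mf1 f1_ge0.
have nu_mu B : measurable B -> nu B + mu (h @^-1` B) = q (h @^-1` B).
  move=> mB; have mhB : measurable (h @^-1` B) by exact: measurable_funPTI.
  rewrite nuf// muE// -ge0_integralD//.
  - under eq_integral => x _.
      rewrite addeC subeK; last first.
        have /andP[f0 f1] := f01 x.
        by rewrite ge0_fin_numE// (le_lt_trans f1) ?ltry.
      over.
    by rewrite integral_cst// mul1e.
  - by move=> x _; have /andP[] := f01 x.
  - exact: measurable_funTS.
  - exact: measurable_funTS.
have mu_le B : measurable B -> mu B <= mu [set: T].
  by move=> mB; apply: le_measure; rewrite ?inE.
have nuT : nu [set: S] \is a fin_num.
  rewrite ge0_fin_numE// (le_lt_trans (nuq _ _))//.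
  by rewrite preimage_setT probability_setT ltry.
have muT : mu [set: T] = 1 - nu [set: S].
  have := nu_mu _ measurableT; rewrite preimage_setT probability_setT => <-.
  by rewrite [X in X - _]addeC addeK.
(* [mnormalize] returns [q] if the mass of [mu] is 0 or infinite. In the first case the factor in
   front of [r] vanishes; the second is excluded since [nu] is finite. *)
exists (mnormalize mu q) => B mB; rewrite -(nu_mu _ mB) -muT; congr (_ + _).
have mhB : measurable (h @^-1` B) by exact: measurable_funPTI.
have mnE : mnormalize mu q (h @^-1` B) =
    if (mu [set: T] == 0) || (mu [set: T] == +oo) then q (h @^-1` B)
    else mu (h @^-1` B) * (fine (mu [set: T]))^-1%:E.
  by rewrite /mnormalize; case: ifPn.
apply: (etrans (congr1 (fun z => mu [set: T] * z) mnE)).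
case: ifPn => [/orP[/eqP muT0|/eqP muTy]|].
- rewrite muT0 mul0e; apply/esym/eqP; rewrite eq_le measure_ge0 andbT -muT0.
  exact: mu_le.
- by move: muTy; rewrite muT; move: nuT; case: (nu [set: S]).
rewrite negb_or => /andP[muT0 muTy].
have muTfin : mu [set: T] \is a fin_num by rewrite ge0_fin_numE// ltey.
rewrite muleCA -{1}(fineK muTfin) -EFinM divff ?mule1//.
by rewrite fine_eq0.
Qed.

(** [rho k] has density [psi k - psi (k-1)], with [psi 0] for [k = 0], and the sum telescopes. In
    the coupling, [rho k] is the law of [W_oo] restricted to [N = k]. *)
Lemma exists_increment_measures (p : {measure set T -> \bar R})
    (psi : nat -> T -> \bar R) :
  (forall n, measurable_fun [set: T] (psi n)) ->
  (forall n x, 0 <= psi n x <= 1) -> (forall x, nondecreasing_seq (psi ^~ x)) ->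
  exists rho : nat -> {measure set T -> \bar R},
    forall n A, measurable A ->
      \sum_(0 <= k < n.+1) rho k A = \int[p]_(x in A) psi n x.
Proof.
move=> mpsi psi01 psi_nd.
have psi_fin n x : psi n x \is a fin_num.
  have /andP[f0 f1] := psi01 n x.
  by rewrite ge0_fin_numE// (le_lt_trans f1) ?ltry.
pose dpsi k x := if k is j.+1 then psi j.+1 x - psi j x else psi 0%N x.
have mdpsi k : measurable_fun [set: T] (dpsi k).
  by case: k => [|k]; [exact: mpsi|exact: emeasurable_funB].
have dpsi0 k x : 0 <= dpsi k x.
  case: k => [|k]; first by have /andP[] := psi01 0%N x.
  by rewrite suber_ge0//; exact: psi_nd.
have /choice[rho rhoE] : forall k, exists m : {measure set T -> \bar R},
    forall A, measurable A -> m A = \int[p]_(x in A) dpsi k x.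
  by move=> k; exact: density_measure.
exists rho => n A mA; under eq_bigr do rewrite rhoE//.
rewrite -ge0_integral_sum//; last by move=> k; exact: measurable_funTS.
apply: eq_integral => x _; elim: n => [|n IHn]; first by rewrite big_nat1.
by rewrite big_nat_recr//= IHn addeC subeK.
Qed.

(** [W n] copies [W_oo] on [N <= n], which contributes [sigma n] to its law; on [N > n] it is an
    independent draw from [r n], which contributes the residual of [q n]. Only the image of [W n]
    under [h n] has a prescribed law. *)
Lemma exists_eventual_coupling (p : probability T R) (q : nat -> probability T R)
    (dS : nat -> measure_display) (S : forall n, measurableType (dS n))
    (h : forall n, {mfun T >-> S n}) (psi : nat -> T -> \bar R) :
  (forall n, measurable_fun [set: T] (psi n)) ->
  (forall n x, 0 <= psi n x <= 1) -> (forall x, nondecreasing_seq (psi ^~ x)) ->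
  (forall e : R, (0 < e)%R -> exists n, 1 - e%:E <= \int[p]_x psi n x) ->
  (forall n B, measurable B ->
    \int[p]_(x in h n @^-1` B) psi n x <= q n (h n @^-1` B)) ->
  exists dQ (Omega' : measurableType dQ) (Q : probability Omega' R)
      (W : nat -> {RV Q >-> T}) (W_oo : {RV Q >-> T}) (N : {RV Q >-> nat}),
    [/\ forall n B, measurable B ->
          Q (W n @^-1` (h n @^-1` B)) = q n (h n @^-1` B),
        forall A, measurable A -> Q (W_oo @^-1` A) = p A
      & forall w n, (N w <= n)%N -> W n w = W_oo w].
Proof.
move=> mpsi psi01 psi_nd psi_mass psi_q.
have [rho rho_sum] := exists_increment_measures p mpsi psi01 psi_nd.
have psi0 n x : 0 <= psi n x by have /andP[] := psi01 n x.
have /choice[sigma sigmaE] : forall n, exists m : {measure set T -> \bar R},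
    forall A, measurable A -> m A = \int[p]_(x in A) psi n x.
  by move=> n; exact: density_measure.
have sigma_le n A : measurable A -> sigma n A <= p A.
  move=> mA; rewrite sigmaE// -[leRHS]mul1e -integral_cst//.
  apply: ge0_le_integral => //; try exact: measurable_funTS.
  by move=> x _; have /andP[] := psi01 n x.
have sigma_fin n A : measurable A -> sigma n A \is a fin_num.
  move=> mA; rewrite ge0_fin_numE// (le_lt_trans (sigma_le n _ mA))//.
  by rewrite ltey_eq fin_num_measure.
(* By [psi_mass] no mass escapes as the index grows, so a finite [N] accounts for all of [p]. *)
have rho_p A : measurable A -> \sum_(k <oo) rho k A = p A.
  move=> mA; apply/eqP; rewrite eq_le; apply/andP; split.
    apply: lime_le; first by apply: is_cvg_nneseries.
    apply: nearW => -[|n]; first by rewrite big_geq.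
    by rewrite rho_sum// -sigmaE// sigma_le.
  apply/lee_addgt0Pr => e e0; have [n psi_n] := psi_mass _ e0.
  apply: (@le_trans _ _ (sigma n A + e%:E)).
    apply: le_probability_of_mass => //; first exact: sigma_le.
    by rewrite sigmaE.
  rewrite leeD2r// sigmaE// -rho_sum//; exact: nneseries_lim_ge.
(* This is the probability of [N > n]. *)
have rho_tail n : \sum_(n.+1 <= k <oo) rho k [set: T] = 1 - sigma n [set: T].
  rewrite -(probability_setT p) -rho_p// (nneseries_split 0 n.+1)//.
  by rewrite add0n rho_sum// -sigmaE// [X in X - _]addeC addeK// sigma_fin.
have /choice[r rE] : forall n, exists r : probability T R, forall B,
    measurable B ->
    sigma n (h n @^-1` B) + (1 - sigma n [set: T]) * r (h n @^-1` B) =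
    q n (h n @^-1` B).
  move=> n.
  have [nu nuE] := exists_pushforward (sigma n) (measurable_funPT (h n)).
  have [|r rE] := @exists_residual (q n) _ _ (h n) nu.
    by move=> B mB; rewrite nuE sigmaE ?psi_q//; exact: measurable_funPTI.
  by exists r => B mB; rewrite -rE// !nuE preimage_setT.
(* [m k] serves on [N = k], where only the coordinates below [k] are read. *)
have /choice[m mE] := exists_finite_marginals r.
(* A point is (N, (W_oo, w)), and the coordinate w n is used when n < N. *)
pose O : measurableType _ := (nat * (T * seq_space T))%type.
have /choice[mu muE] : forall k, exists mu : {measure set O -> \bar R},
    forall A, mu A = (rho k \x m k) [set x | A (k, x)].
  by move=> k; apply: exists_pushforward; exact: pair1_measurable.
pose Q0 : {measure set O -> \bar R} := mseries mu 0.
have Q0T : Q0 [set: O] = 1.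
  rewrite -(probability_setT p) -rho_p//; apply: eq_eseriesr => k _.
  rewrite muE -[RHS]mule1 -(probability_setT (m k)) -product_measure1E//.
  by rewrite setXTT.
pose Q : probability O R := probability_of_measure Q0T.
have mW n : measurable_fun [set: O]
    (fun w : O => if (w.1 <= n)%N then w.2.1 else seq_coord n w.2.2).
  apply: measurable_fun_ifT => //=.
  - by apply: (measurableT_comp (f := fun k : nat => (k <= n)%N)).
  - exact: measurableT_comp.
  - apply: (measurableT_comp (measurable_seq_coord _)).
    exact: measurableT_comp.
have mN : measurable_fun [set: O] (fst : O -> nat) by exact: measurable_fst.
have mW_oo : measurable_fun [set: O] (fun w : O => w.2.1).
  exact: measurableT_comp.
exists _, O, Q, (fun n => mfun_of_measurable (mW n)),
  (mfun_of_measurable mW_oo), (mfun_of_measurable mN).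
have TE (k : nat) A : measurable A -> mu k [set w | A w.2.1] = rho k A.
  move=> mA; rewrite muE -[RHS]mule1 -(probability_setT (m k)).
  rewrite -product_measure1E//.
  by congr product_measure1; apply/seteqP; split=> [x|x []].
split=> /= [n B mB|A mA|w n Nw]; last by rewrite Nw.
- have mA : measurable (h n @^-1` B) by exact: measurable_funPTI.
  set A := _ @^-1` B in mA *.
  (* The summand is the contribution of the event [N = k]. *)
  transitivity (\sum_(k <oo)
      if (k <= n)%N then rho k A else rho k [set: T] * r n A).
    apply: eq_eseriesr => k _; case: ifPn => kn.
      rewrite -TE// !muE.
      by congr product_measure1; apply/seteqP; split=> x /=; rewrite kn.
    rewrite -ltnNge in kn.
    rewrite muE -(mE k n)// -product_measure1E//.
      by congr product_measure1; apply/seteqP; split=> [x|x []] /=;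
        rewrite leqNgt kn.
    by rewrite -[X in measurable X]setTI; exact: measurable_seq_coord.
  rewrite (nneseries_split 0 n.+1); last first.
    by move=> k _; case: ifPn => // _; rewrite mule_ge0.
  rewrite add0n -[RHS]rE// -rho_tail; congr (_ + _).
    rewrite sigmaE// -rho_sum// !big_mkord; apply: eq_bigr => k _.
    by rewrite -ltnS ltn_ord.
  rewrite muleC -(fineK (fin_num_measure (r n) _ mA)) -nneseriesZl//.
  (* Reindexing turns [k] into [k + n.+1], which decides the conditional. *)
  rewrite -nneseries_addn; last first.
    by move=> k; case: ifPn => // _; rewrite mule_ge0// lee_fin fine_ge0.
  rewrite -[in RHS]nneseries_addn; last first.
    by move=> k; rewrite mule_ge0// lee_fin fine_ge0.
  apply: eq_eseriesr => k _.
  by rewrite leqNgt leq_addl/= muleC.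
- by rewrite -rho_p//; apply: eq_eseriesr => k _; exact: TE.
Qed.

End coupling.

(** * Slow indices and the mass of tail infima *)

(** [kappa] advances by one exactly when the threshold of the next value has been reached; [m 0 = 0]
    makes the starting value admissible. *)
Lemma exists_slow_index (m : nat -> nat) : m 0 = 0%N ->
  exists kappa : nat -> nat, [/\ forall n, (m (kappa n) <= n)%N,
    {homo kappa : i j / (i <= j)%N} & forall K, exists n, (K <= kappa n)%N].
Proof.
move=> m0; pose kappa := fix F n : nat :=
  if n is j.+1 then if (m (F j).+1 <= j.+1)%N then (F j).+1 else F j else 0%N.
have kappa_nd : {homo kappa : i j / (i <= j)%N}.
  by apply: homo_leq => // [? ? ?|n]; [exact: leq_trans|rewrite /=; case: ifP].
exists kappa; split=> //.
  by elim=> [|n IHn]; [rewrite m0|rewrite /=; case: ifP => // _; exact: leqW].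
elim=> [|K [n Kn]]; first by exists 0%N.
(* At time [n'.+1] either [kappa] advances from a value at least [K], or it is blocked; the value
   [K] cannot be blocked since [m K.+1 <= n'], so [kappa n'] already exceeds [K]. *)
pose n' := maxn n (m K.+1).
have Kn' : (K <= kappa n')%N.
  by apply: leq_trans Kn _; rewrite kappa_nd// leq_maxl.
exists n'.+1; rewrite /=; case: ifPn => [_|]; first by rewrite ltnS.
rewrite leqNgt negbK => n'm; rewrite ltn_neqAle Kn' andbT.
by apply: contraTneq n'm => <-; rewrite -leqNgt leqW// leq_maxr.
Qed.

(** One minus the infimum over [n >= k] is at most the sum of the [1 - phi n] over [n >= k], whose
    integral is bounded by a geometric series with sum 2/2^k. *)
Lemma integral_einfs_ge (R : realType) d (T : measurableType d)
    (p : probability T R) (phi : nat -> T -> \bar R) :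
  (forall n, measurable_fun [set: T] (phi n)) ->
  (forall n x, (0 <= phi n x <= 1)%E) ->
  (forall n, (1 - (2 / (2 ^ n.+1)%:R)%:E <= \int[p]_x phi n x)%E) ->
  forall k, (1 - (2 / 2 ^+ k)%:E <= \int[p]_x einfs (fun n => phi n x) k)%E.
Proof.
move=> mphi phi01 phi_mass k.
have int1 : (\int[p]_x cst 1 x = 1)%E.
  by rewrite integral_cst// mul1e; exact: probability_setT.
have phi0 n x : (0 <= phi n x)%E by have /andP[] := phi01 n x.
have mcphi n : measurable_fun [set: T] (fun x => (1 - phi n x)%E).
  exact: emeasurable_funB.
have cphi0 n x : (0 <= 1 - phi n x)%E.
  by rewrite subre_ge0//; have /andP[] := phi01 n x.
have phi_fin n x : phi n x \is a fin_num.
  have /andP[f0 f1] := phi01 n x.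
  by rewrite ge0_fin_numE// (le_lt_trans f1) ?ltry.
have int_fin n : (\int[p]_x phi n x)%E \is a fin_num.
  rewrite ge0_fin_numE ?integral_ge0//.
  apply: (@le_lt_trans _ _ (\int[p]_x cst 1 x)%E).
    by apply: ge0_le_integral => // x _; have /andP[] := phi01 n x.
  by rewrite int1 ltry.
have int_cphi n : (\int[p]_x (1 - phi n x) <= (2 / (2 ^ n.+1)%:R)%:E)%E.
  have : (\int[p]_x (1 - phi n x) + \int[p]_x phi n x = 1)%E.
    rewrite -ge0_integralD//; under eq_integral do rewrite subeK//.
    exact: int1.
  move=> /(congr1 (fun z => z - \int[p]_x phi n x)%E); rewrite addeK// => ->.
  by rewrite leeBlDr// addeC -leeBlDr//; exact: phi_mass.
pose s x := (\sum_(i <oo) (1 - phi (i + k)%N x))%E.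
have ms : measurable_fun [set: T] s by exact: ge0_emeasurable_sum.
have s0 x : (0 <= s x)%E by apply: nneseries_ge0 => n _ _; exact: cphi0.
pose g x := einfs (fun n => phi n x) k.
have mg : measurable_fun [set: T] g by exact: measurable_fun_einfs.
have g0 x : (0 <= g x)%E by apply: le_ereal_inf_tmp => _ [n _ <-].
rewrite leeBlDr// -int1.
apply: (@le_trans _ _ (\int[p]_x (g x + s x))%E).
  apply: ge0_le_integral => //; first exact: emeasurable_funD.
  move=> x _; have [s_fin|] := boolP (s x \is a fin_num); last first.
    rewrite ge0_fin_numE// -leNgt leye_eq => /eqP ->.
    by rewrite addey ?leey// gt_eqF// (@lt_le_trans _ _ 0%E) ?ltNy0.
  rewrite -leeBlDr//; apply: le_ereal_inf_tmp => _ [n /= kn <-].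
  rewrite leeBlDr// addeC -leeBlDr// /s (nneseriesD1 (n := (n - k)%N))//.
  by rewrite subnK//; apply: leeDl; apply: nneseries_ge0 => i _ _; exact: cphi0.
rewrite ge0_integralD// leeD2l// integral_nneseries//.
rewrite -(cvg_lim _ (@cvg_geometric_eseries_half R 2 k))//.
apply: lee_nneseries => n _; first by move=> _; exact: integral_ge0.
by rewrite addnS; exact: int_cphi.
Qed.

(** * Comparison of segments of different lengths *)

Section segments.
Context (R : realType) (d : time R -> measure_display).
Context (E : forall s, measurableType (d s)) (H : set (forall s, E s)).
Context (H0 : H !=set0).

Lemma path_proj_le (t t' : R) (z z' : path_space H0) : t <= t' ->
  path_proj t' z = path_proj t' z' -> path_proj t z = path_proj t z'.
Proof.
move=> tt' /(congr1 sval) zz'; apply: val_inj => /=.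
apply: functional_extensionality_dep => s.
have st' : (sval (sval s) < t'%:E)%E.
  by apply: lt_le_trans (svalP s) _; rewrite lee_fin.
exact: (congr1 (fun f => f (exist _ (sval s) st')) zz').
Qed.

(** The longer segment determines the shorter one, so the image [B'] has the same preimage as [B];
    measurability in a segment space is by definition that of the preimage. *)
Lemma path_proj_preimage_le (t t' : R) (B : set (segment_space H0 t)) :
  t <= t' -> measurable B ->
  exists2 B' : set (segment_space H0 t'), measurable B' &
    path_proj t' @^-1` B' = path_proj t @^-1` B.
Proof.
move=> tt' mB; pose B' := path_proj t' @` (path_proj t @^-1` B).
have B'E : path_proj t' @^-1` B' = path_proj t @^-1` B.
  apply/seteqP; split=> [z [z' Bz' zz']|z Bz]; last by exists z.
  by rewrite /= -(path_proj_le tt' zz').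
exists B' => //; change (measurable (path_proj t' @^-1` B')).
by rewrite B'E; exact: mB.
Qed.

End segments.

(** Continuity from below: the events [N <= n] exhaust the space. *)
Lemma eventually_large_event (R : realType) d (T : measurableType d)
    (p : probability T R) (N : {RV p >-> nat}) (e : R) : 0 < e ->
  exists n, (1 - e%:E < p [set w | (N w <= n)%N])%E.
Proof.
move=> e0; pose F n := [set w | (N w <= n)%N].
have mF n : measurable (F n).
  by rewrite -[F n]/(N @^-1` [set k | (k <= n)%N]); exact: measurable_funPTI.
have F_nd : nondecreasing_seq F.
  by move=> i j ij; apply/subsetPset => w /= /leq_trans; exact.
have FT : \bigcup_n F n = setT.
  by apply/seteqP; split=> [//|w _]; exists (N w) => //; exact: leqnn.
have pF_nd : nondecreasing_seq (p \o F).
  move=> i j ij; apply: le_measure; rewrite ?inE//; exact/subsetPset/F_nd.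
have sup1 : ereal_sup (range (p \o F)) = 1%E.
  transitivity (p (\bigcup_n F n)); last by rewrite FT probability_setT.
  apply: (cvg_unique _ (ereal_nondecreasing_cvgn pF_nd)) => //.
  by apply: nondecreasing_cvg_mu => //; exact: bigcupT_measurable.
have [|_ [n _ <-] pFn] := @ereal_sup_gt _ (range (p \o F)) (1 - e%:E)%E.
  by rewrite sup1 -EFinB lte_fin ltrBlDr ltrDl.
by exists n.
Qed.

(* MathComp-Analysis. The sequences (Z_n) and (t_n) are indexed by nat from 0,
   so that N takes values in {0, 1, ...} in place of {1, 2, ...}. *)
Theorem theorem1 (R : realType) (d : time R -> measure_display)
    (E : forall s : time R, measurableType (d s))
    (H : set (forall s : time R, E s)) (H0 : H !=set0)
    (dO : nat -> measure_display) (Omega : forall n, measurableType (dO n))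
    (P : forall n, probability (Omega n) R)
    (Z : forall n, {RV (P n) >-> path_space H0})
    (dO_oo : measure_display) (Omega_oo : measurableType dO_oo)
    (P_oo : probability Omega_oo R) (Z_oo : {RV P_oo >-> path_space H0}) :
  (forall t : R, 0 <= t ->
     cvg_in_density (fun n => path_segment t (Z n)) (path_segment t Z_oo))
  <->
  (exists t : nat -> R,
     [/\ forall n, 0 <= t n, nondecreasing_seq t, t @ \oo --> +oo
       & exists (dQ : measure_display) (Omega' : measurableType dQ)
           (Q : probability Omega' R)
           (Zhat : forall n, {RV Q >-> segment_space H0 (t n)})
           (Zhat_oo : {RV Q >-> path_space H0}),
           is_coupling (fun n => path_segment (t n) (Z n)) Z_oo Zhat Zhat_oo /\
           exists N : {RV Q >-> nat},
             forall (w : Omega') (n : nat), (N w <= n)%N ->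
               Zhat n w = path_proj (t n) (Zhat_oo w)]).
Proof.
split=> [Zcvg|[t [t0 t_nd t_oo]]]; last first.
  move=> [dQ [Om [Q [Zhat [Zhat_oo [[Zhat_law Zhat_oo_law] [N ZhatN]]]]]]] s s0.
  apply: common_part_cvg_in_density => e e0.
  have [n0 n0e] := eventually_large_event N e0.
  have [n1 _ tn1] : \forall n \near \oo, s <= t n.
    by move/cvgryPge : t_oo; exact.
  pose D := [set w | (N w <= n0)%N].
  have mD : measurable D.
    by rewrite -[D]/(N @^-1` [set k | (k <= n0)%N]); exact: measurable_funPTI.
  have [nu nuE] := exists_pushforward (mrestr Q mD)
    (measurable_funPT (path_segment s Zhat_oo)).
  (* Beyond [n0] the coupled segments agree on [D]; beyond [n1] they cover the times before [s]. *)
  exists nu, (maxn n0 n1); split; last first.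
    suff -> : nu setT = Q D by exact: n0e.
    by rewrite nuE preimage_setT; exact: (congr1 Q (setTI D)).
  move=> B mB; rewrite nuE; split=> [|n].
    have -> : distribution P_oo (path_segment s Z_oo) B =
        distribution Q Zhat_oo (path_proj s @^-1` B).
      by rewrite Zhat_oo_law//; exact: measurable_funPTI.
    apply: le_measure; rewrite ?inE//.
    - by apply: measurableI => //; exact: measurable_funPTI.
    - by do 2 apply: measurable_funPTI.
  rewrite geq_max => /andP[n0n n1n].
  (* The law of [Zhat n] is known only on the segment up to [t n], so [B] is first rewritten as an
     event [B'] there. *)
  have [B' mB' B'E] := path_proj_preimage_le (tn1 _ n1n) mB.
  have -> : distribution (P n) (path_segment s (Z n)) B =
      distribution Q (Zhat n) B'.
    transitivity (distribution (P n) (path_segment (t n) (Z n)) B').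
      exact: (congr1 (fun A => P n (Z n @^-1` A)) (esym B'E)).
    by apply/esym; exact: Zhat_law.
  apply: le_measure; rewrite ?inE//.
  - by apply: measurableI => //; exact: measurable_funPTI.
  - exact: measurable_funPTI.
  move=> w [/= Bw Nw]; rewrite /= ZhatN ?(leq_trans Nw)//.
  by rewrite -[B' _]/((path_proj (t n) @^-1` B') (Zhat_oo w)) B'E.
pose p : probability (path_space H0) R := distribution P_oo Z_oo.
pose q n : probability (path_space H0) R := distribution (P n) (Z n).
(* The last clause makes the index 0 admissible for every n. *)
have /choice[phim phimP] : forall k : nat,
    exists phim : (path_space H0 -> \bar R) * nat,
    [/\ measurable_fun [set: path_space H0] phim.1,
      (forall z, 0 <= phim.1 z <= 1)%E,
      (1 - (2 / (2 ^ k.+1)%:R)%:E <= \int[p]_z phim.1 z)%E,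
      (forall n B, (phim.2 <= n)%N -> measurable B ->
        \int[p]_(z in path_proj k%:R @^-1` B) phim.1 z <=
        q n (path_proj k%:R @^-1` B))%E
      & k = 0%N -> phim.2 = 0%N].
  move=> [|k].
    (* For [k = 0] the required mass is 1 - 2/2 = 0, so the zero function suffices. *)
    exists (cst 0%E, 0%N); split=> //=.
    - by move=> _; rewrite lexx lee01.
    - by rewrite integral0 expn1 divff// subee.
    - by move=> n B _ mB; rewrite integral0.
  have e0 : 0 < 2 / (2 ^ k.+2)%:R :> R by rewrite divr_gt0// ltr0n expn_gt0.
  have [nu [m [nu_common nu_mass]]] :=
    cvg_in_density_common_part (Zcvg k.+1%:R (ler0n _ _)) e0.
  have [phi [mphi phi01 nuE]] := exists_density_comp (h := path_proj k.+1%:R)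
    (p := p) (fun B mB => (nu_common B mB).1).
  exists (phi, m); split=> //=.
  - by apply: ltW; rewrite nuE// preimage_setT in nu_mass.
  - by move=> n B mn mB; rewrite -nuE//; exact: (nu_common B mB).2.
pose phi k := (phim k).1; pose m k := (phim k).2.
have mphi k : measurable_fun [set: path_space H0] (phi k) by have [] := phimP k.
have phi01 k z : (0 <= phi k z <= 1)%E.
  by have [_ phi01 _ _ _] := phimP k; exact: phi01.
have phi_mass k : (1 - (2 / (2 ^ k.+1)%:R)%:E <= \int[p]_z phi k z)%E.
  by have [] := phimP k.
have [|kappa [m_kappa kappa_nd kappa_oo]] := @exists_slow_index m.
  by have [_ _ _ _ m0] := phimP 0%N; exact: m0.
pose psi n z := einfs (fun j => phi j z) (kappa n).
have einfs_phi0 k z : (0 <= einfs (fun j => phi j z) k)%E.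
  by apply: le_ereal_inf_tmp => _ [j _ <-]; have /andP[] := phi01 j z.
have einfs_phi_le k z : (einfs (fun j => phi j z) k <= phi k z)%E.
  by apply: ereal_inf_lbound; exists k => /=.
have [|||||dQ [Om [Q [W [W_oo [N [W_law W_oo_law WN]]]]]]] :=
  @exists_eventual_coupling R _ _ p q _ _ (fun n => path_proj (kappa n)%:R) psi.
- by move=> n; exact: measurable_fun_einfs.
- move=> n z; rewrite einfs_phi0 (le_trans (einfs_phi_le _ _))//.
  by have /andP[] := phi01 (kappa n) z.
- by move=> z i j ij; apply: nondecreasing_einfs; exact: kappa_nd.
(* If [K = kappa n] exceeds 2/e, then so does 2^K, whence 2/2^K is at most [e]. *)
- move=> e e0; have [n n_e] := kappa_oo (Num.truncn (2 / e)).+1; exists n.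
  apply: le_trans (integral_einfs_ge mphi phi01 phi_mass (kappa n)).
  rewrite leeB// lee_fin ler_pdivrMr ?exprn_gt0// mulrC -ler_pdivrMr// -natrX.
  apply: ltW; apply: lt_le_trans (truncnS_gt _) _.
  by rewrite ler_nat (leq_trans n_e)// ltnW// ltn_expl.
- move=> n B mB.
  have mhB : measurable (path_proj (H0 := H0) (kappa n)%:R @^-1` B).
    exact: measurable_funPTI.
  have [_ _ _ phi_q _] := phimP (kappa n).
  apply: le_trans (phi_q n B (m_kappa n) mB).
  apply: ge0_le_integral => //; first by move=> z _; exact: einfs_phi0.
  - by apply: measurable_funTS; exact: measurable_fun_einfs.
  - exact: measurable_funTS (mphi (kappa n)).
  - by move=> z _; exact: einfs_phi_le.
exists (fun n => (kappa n)%:R); split=> //.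
- by move=> i j ij; rewrite ler_nat kappa_nd.
- apply/cvgryPge => A; have [n0 n0A] := kappa_oo (Num.truncn A).+1.
  exists n0 => //= n n0n; apply: ltW; apply: lt_le_trans (truncnS_gt _) _.
  by rewrite ler_nat (leq_trans n0A)// kappa_nd.
(* The coupled segments are cut from the full paths [W n], of which only these segments have the
   required law. *)
exists dQ, Om, Q, (fun n => path_segment (kappa n)%:R (W n)), W_oo; split.
  split=> [n B mB|A mA]; last exact: W_oo_law.
  exact: W_law.
by exists N => w n Nn; rewrite /= WN.
Qed.
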